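(* Let $X$ be a geodesic metric space of finite affine rank and let $X=Y_0\times Y_1\times\dots\times Y_n$ be its direct product decomposition in which $Y_0$ is a Euclidean space (possibly a point) and $Y_1,\dots,Y_n$ are irreducible metric spaces isometric neither to the real line nor to a point. Denote by $\mathcal P$ the group of all permutations $s$ of $\{1,\dots,n\}$ such that $Y_i$ and $Y_{s(i)}$ are isometric for all $i=1,\dots,n$. Then there is a natural exact sequence $$1\to \mathrm{Iso}(Y_0)\times \mathrm{Iso}(Y_1)\times\dots\times \mathrm{Iso}(Y_n)\xrightarrow{\ i\ }\mathrm{Iso}(X)\xrightarrow{\ p\ }\mathcal P\to 1 .$$
   Context: $\mathrm{Iso}(X)$ denotes the group of isometries of a metric space $X$ onto itself. Direct product: for metric spaces $Y,Z$, $Y\times Z$ is the Cartesian product with metric $d((y,z),(\bar y,\bar z))=\sqrt{d^2(y,\bar y)+d^2(z,\bar z)}$, and similarly for finitely many factors. An equality $X=Y_0\times\dots\times Y_n$ means that an isometry $X\to Y_0\times\dots\times Y_n$ is fixed. A metric space $X$ is irreducible if for each decomposition $X=Y\times Z$ one of the factors is a point. A geodesic is an isometric embedding of an interval; a metric space is geodesic if each pair of its points is connected by a geodesic. A metric space is affine if it is isometric to a linearly convex subset of a normed vector space. The affine rank of $X$ is the supremum of the topological dimensions of affine metric spaces that admit an isometric embedding into $X$. *)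

(* Defs.v *)
From HB Require Import structures.
From mathcomp Require Import all_boot all_order all_algebra all_fingroup.
From mathcomp Require Import all_classical all_reals all_analysis.
From mathcomp Require Import ring lra.

Set Implicit Arguments.
Unset Strict Implicit.
Unset Printing Implicit Defensive.

Import Order.TTheory GRing.Theory Num.Theory.
Import numFieldNormedType.Exports.

Local Open Scope classical_set_scope.
Local Open Scope ring_scope.

Section L2Norm.
Variables (R : rcfType) (I : finType).
Implicit Types a b c : I -> R.

Lemma l2_cauchy_schwarz a b :
  (\sum_i a i * b i) ^+ 2 <= (\sum_i a i ^+ 2) * (\sum_i b i ^+ 2).
Proof.
have : 0 <= \sum_i \sum_j (a i * b j - a j * b i) ^+ 2.
  by apply: sumr_ge0 => i _; apply: sumr_ge0 => j _; exact: sqr_ge0.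
have -> : \sum_i \sum_j (a i * b j - a j * b i) ^+ 2 =
    \sum_i \sum_j (a i ^+ 2 * b j ^+ 2) +
    \sum_i \sum_j (b i ^+ 2 * a j ^+ 2) -
    2 * \sum_i \sum_j ((a i * b i) * (a j * b j)).
  rewrite mulr_sumr -big_split -sumrB; apply: eq_bigr => i _ /=.
  rewrite mulr_sumr -big_split -sumrB; apply: eq_bigr => j _ /=.
  by ring.
rewrite -!big_distrlr /=; nra.
Qed.

Lemma l2_minkowski a b c : (forall i, 0 <= c i <= a i + b i) ->
  Num.sqrt (\sum_i c i ^+ 2) <=
  Num.sqrt (\sum_i a i ^+ 2) + Num.sqrt (\sum_i b i ^+ 2).
Proof.
move=> hc.
have A0 : 0 <= \sum_i a i ^+ 2 by apply: sumr_ge0 => i _; exact: sqr_ge0.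
have B0 : 0 <= \sum_i b i ^+ 2 by apply: sumr_ge0 => i _; exact: sqr_ge0.
have C0 : 0 <= \sum_i c i ^+ 2 by apply: sumr_ge0 => i _; exact: sqr_ge0.
rewrite -ler_sqr ?nnegrE ?addr_ge0 ?sqrtr_ge0// sqrrD !sqr_sqrtr//.
have le_c : \sum_i c i ^+ 2 <=
    \sum_i a i ^+ 2 + \sum_i b i ^+ 2 + 2 * \sum_i a i * b i.
  rewrite mulr_sumr -!big_split /=; apply: ler_sum => i _.
  by have /andP[] := hc i; nra.
have le_ab : \sum_i a i * b i <=
    Num.sqrt (\sum_i a i ^+ 2) * Num.sqrt (\sum_i b i ^+ 2).
  rewrite -sqrtrM//; apply: le_trans (ler_norm _) _.
  by rewrite -sqrtr_sqr ler_wsqrtr// l2_cauchy_schwarz.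
lra.
Qed.
End L2Norm.

(* The product types of the library carry the sup distance; the two aliases
   below carry the l^2 distance. *)
Definition l2prod (R : realType) (I : finType) (Y : I -> metricType R) : Type :=
  forall i, Y i.

Section L2Prod.
Variables (R : realType) (I : finType) (Y : I -> metricType R).
Implicit Types x y z : l2prod Y.

HB.instance Definition _ := Choice.copy (l2prod Y) (forall i, Y i).

Definition l2dist x y : R := Num.sqrt (\sum_i mdist (x i) (y i) ^+ 2).

Lemma l2distxx x : l2dist x x = 0.
Proof.
by rewrite /l2dist big1 ?sqrtr0// => i _; rewrite mdistxx expr0n.
Qed.

Lemma l2dist_positivity x y : l2dist x y = 0 -> x = y.
Proof.
move=> /eqP; rewrite sqrtr_eq0 => le0; apply: functional_extensionality_dep.
have sum0 : \sum_i mdist (x i) (y i) ^+ 2 = 0.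
  by apply/eqP; rewrite eq_le le0 sumr_ge0// => i _; exact: sqr_ge0.
move=> i; apply: mdist_positivity; apply/eqP; rewrite -sqrf_eq0; apply/eqP.
by apply: (psumr_eq0P _ sum0) => // j _; exact: sqr_ge0.
Qed.

Lemma l2dist_sym x y : l2dist x y = l2dist y x.
Proof. by congr Num.sqrt; apply: eq_bigr => i _; rewrite metric_sym. Qed.

Lemma l2dist_triangle y x z : l2dist x z <= l2dist x y + l2dist y z.
Proof. by apply: l2_minkowski => i; rewrite mdist_ge0 metric_triangle. Qed.

HB.instance Definition _ := isMetric.Build R (l2prod Y)
  l2distxx l2dist_positivity l2dist_sym l2dist_triangle.
End L2Prod.

Definition l2pair (R : realType) (Y Z : metricType R) : Type := (Y * Z)%type.

Section L2Pair.
Variables (R : realType) (Y Z : metricType R).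
Implicit Types x y z : l2pair Y Z.

HB.instance Definition _ := Choice.copy (l2pair Y Z) (Y * Z)%type.

Definition l2pair_dist x y : R :=
  Num.sqrt (mdist x.1 y.1 ^+ 2 + mdist x.2 y.2 ^+ 2).

Lemma l2pair_distxx x : l2pair_dist x x = 0.
Proof. by rewrite /l2pair_dist !mdistxx expr0n addr0 sqrtr0. Qed.

Lemma l2pair_dist_positivity x y : l2pair_dist x y = 0 -> x = y.
Proof.
move=> /eqP; rewrite sqrtr_eq0 => le0.
have : mdist x.1 y.1 ^+ 2 + mdist x.2 y.2 ^+ 2 == 0.
  by rewrite eq_le le0 addr_ge0// sqr_ge0.
rewrite paddr_eq0 ?sqr_ge0// !sqrf_eq0 => /andP[/eqP d1 /eqP d2].
by case: x y d1 d2 {le0} => [x1 x2] [y1 y2] /= /mdist_positivity->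
  /mdist_positivity->.
Qed.

Lemma l2pair_dist_sym x y : l2pair_dist x y = l2pair_dist y x.
Proof. by rewrite /l2pair_dist metric_sym [mdist x.2 _]metric_sym. Qed.

Lemma l2pair_dist_triangle y x z :
  l2pair_dist x z <= l2pair_dist x y + l2pair_dist y z.
Proof.
have := @l2_minkowski R bool
  (fun b => if b then mdist x.1 y.1 else mdist x.2 y.2)
  (fun b => if b then mdist y.1 z.1 else mdist y.2 z.2)
  (fun b => if b then mdist x.1 z.1 else mdist x.2 z.2).
rewrite !big_bool; apply => -[]; by rewrite mdist_ge0 metric_triangle.
Qed.

HB.instance Definition _ := isMetric.Build R (l2pair Y Z)
  l2pair_distxx l2pair_dist_positivity l2pair_dist_sym l2pair_dist_triangle.
End L2Pair.

Definition isometric_embedding (R : realType) (X Y : metricType R)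
    (f : X -> Y) : Prop :=
  forall x x', mdist (f x) (f x') = mdist x x'.

Record isometric_bij (R : realType) (X Y : metricType R) : Type :=
    IsometricBij {
  isometry_fun :> X -> Y;
  isometry_dist : isometric_embedding isometry_fun;
  isometry_onto : forall y, exists x, isometry_fun x = y
}.

Section IsometryTheory.
Variable R : realType.
Implicit Types X Y Z : metricType R.

Lemma isometryP X Y (f g : isometric_bij X Y) : f =1 g -> f = g.
Proof.
case: f g => [f fd fo] [g gd go] /= /funext fg; subst g.
by congr IsometricBij; exact: Prop_irrelevance.
Qed.

Definition isometry_id X : isometric_bij X X :=
  IsometricBij (fun _ _ => erefl) (fun x => ex_intro _ x erefl).

Lemma isometry_comp_dist X Y Z (f : isometric_bij X Y) (g : isometric_bij Y Z) :
  isometric_embedding (g \o f).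
Proof. by move=> x x' /=; rewrite !isometry_dist. Qed.

Lemma isometry_comp_onto X Y Z (f : isometric_bij X Y)
    (g : isometric_bij Y Z) z :
  exists x, (g \o f) x = z.
Proof.
have [y <-] := isometry_onto g z; have [x <-] := isometry_onto f y.
by exists x.
Qed.

Definition isometry_comp X Y Z (f : isometric_bij X Y) (g : isometric_bij Y Z) :
    isometric_bij X Z :=
  IsometricBij (isometry_comp_dist f g) (isometry_comp_onto f g).

Definition isometry_preimage X Y (f : isometric_bij X Y) (y : Y) : X :=
  sval (cid (isometry_onto f y)).

Lemma isometry_preimageK X Y (f : isometric_bij X Y) :
  cancel (isometry_preimage f) f.
Proof. by move=> y; exact: (svalP (cid (isometry_onto f y))). Qed.

Lemma isometryK X Y (f : isometric_bij X Y) : cancel f (isometry_preimage f).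
Proof.
move=> x; apply: mdist_positivity.
by rewrite -(isometry_dist f) isometry_preimageK mdistxx.
Qed.

Lemma isometry_preimage_dist X Y (f : isometric_bij X Y) :
  isometric_embedding (isometry_preimage f).
Proof. by move=> y y'; rewrite -(isometry_dist f) !isometry_preimageK. Qed.

Definition isometry_inv X Y (f : isometric_bij X Y) : isometric_bij Y X :=
  IsometricBij (@isometry_preimage_dist _ _ f)
    (fun x => ex_intro _ (f x) (isometryK f x)).

Definition isometric X Y : Prop := inhabited (isometric_bij X Y).
End IsometryTheory.

Definition Iso (R : realType) (X : metricType R) : Type := isometric_bij X X.

(* As in {perm T}, the product f * g is "f, then g". *)
Section IsoGroup.
Variables (R : realType) (X : metricType R).

HB.instance Definition _ := gen_eqMixin (Iso X).
HB.instance Definition _ := gen_choiceMixin (Iso X).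

Definition Iso_one : Iso X := isometry_id X.
Definition Iso_inv (f : Iso X) : Iso X := isometry_inv f.
Definition Iso_mul (f g : Iso X) : Iso X := isometry_comp f g.

Lemma Iso_mulA : associative Iso_mul.
Proof. by move=> f g h; exact: isometryP. Qed.

Lemma Iso_mul1 : left_id Iso_one Iso_mul.
Proof. by move=> f; exact: isometryP. Qed.

Lemma Iso_1mul : right_id Iso_one Iso_mul.
Proof. by move=> f; exact: isometryP. Qed.

Lemma Iso_mulV : left_inverse Iso_one Iso_inv Iso_mul.
Proof. by move=> f; apply: isometryP => x /=; rewrite isometry_preimageK. Qed.

Lemma Iso_Vmul : right_inverse Iso_one Iso_inv Iso_mul.
Proof. by move=> f; apply: isometryP => x /=; rewrite isometryK. Qed.

HB.instance Definition _ := isGroup.Build (Iso X)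
  Iso_mulA Iso_mul1 Iso_1mul Iso_mulV Iso_Vmul.
End IsoGroup.

Definition prodgroup (I : Type) (G : I -> groupType) : Type := forall i, G i.

Section ProdGroup.
Local Open Scope group_scope.
Variables (I : Type) (G : I -> groupType).

HB.instance Definition _ := Choice.copy (prodgroup G) (forall i, G i).

Definition prodgroup_one : prodgroup G := fun i => 1.
Definition prodgroup_inv (f : prodgroup G) : prodgroup G := fun i => (f i)^-1.
Definition prodgroup_mul (f g : prodgroup G) : prodgroup G :=
  fun i => f i * g i.

Lemma prodgroup_mulA : associative prodgroup_mul.
Proof.
by move=> f g h; apply: functional_extensionality_dep => i; exact: mulgA.
Qed.

Lemma prodgroup_mul1 : left_id prodgroup_one prodgroup_mul.
Proof.
by move=> f; apply: functional_extensionality_dep => i; exact: mul1g.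
Qed.

Lemma prodgroup_1mul : right_id prodgroup_one prodgroup_mul.
Proof.
by move=> f; apply: functional_extensionality_dep => i; exact: mulg1.
Qed.

Lemma prodgroup_mulV : left_inverse prodgroup_one prodgroup_inv prodgroup_mul.
Proof.
by move=> f; apply: functional_extensionality_dep => i; exact: mulVg.
Qed.

Lemma prodgroup_Vmul : right_inverse prodgroup_one prodgroup_inv prodgroup_mul.
Proof.
by move=> f; apply: functional_extensionality_dep => i; exact: mulgV.
Qed.

HB.instance Definition _ := isGroup.Build (prodgroup G)
  prodgroup_mulA prodgroup_mul1 prodgroup_1mul prodgroup_mulV prodgroup_Vmul.
End ProdGroup.

Definition short_exact (G H K : groupType)
    (i : {multiplicative G -> H}) (p : {multiplicative H -> K}) : Prop :=
  [/\ injective i, range i = p @^-1` [set 1%g] & range p = [set: K]].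

Definition is_point (T : Type) : Prop := exists x : T, [set: T] = [set x].

Definition irreducible (R : realType) (X : metricType R) : Prop :=
  forall Y Z : metricType R, isometric X (l2pair Y Z) ->
    is_point Y \/ is_point Z.

Definition euclidean (R : realType) (X : metricType R) : Prop :=
  exists k : nat, isometric X (l2prod (fun _ : 'I_k => R^o : metricType R)).

Definition geodesic (R : realType) (X : metricType R) : Prop :=
  forall x y : X, exists (a b : R) (c : R -> X),
    [/\ a <= b,
        {in `[a, b] &, forall s t, mdist (c s) (c t) = `|s - t|},
        c a = x & c b = y].

Definition affine (R : realType) (A : metricType R) : Prop :=
  exists (V : normedModType R) (f : A -> V),
    (forall x y, mdist x y = `|f x - f y|) /\ convex_set (range f).

(* Lebesgue covering dimension: the least d such that every open cover has an
   open refinement in which no point lies in more than d + 1 members; it is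
   -1 for the empty space. *)
Definition covering_order_le (T : topologicalType) (m : nat) : Prop :=
  forall U : set (set T), (forall A, U A -> open A) -> cover U id = [set: T] ->
  exists V : set (set T),
    [/\ forall B, V B -> open B, cover V id = [set: T],
        forall B, V B -> exists2 A, U A & B `<=` A &
        forall x, ([set B | V B /\ B x] #<= `I_m)%card].

Definition topological_dim (R : realType) (T : topologicalType) : \bar R :=
  ereal_inf [set (m%:R - 1)%:E | m in [set m | covering_order_le T m]].

Definition affine_rank (R : realType) (X : metricType R) : \bar R :=
  ereal_sup [set d | exists A : metricType R,
    [/\ affine A, exists f : A -> X, isometric_embedding f &
        d = topological_dim R A]].

Section FactorPermutations.
Variables (R : realType) (n : nat) (Y : 'I_n.+1 -> metricType R).

(* The factors Y_1, ..., Y_n are the Y (lift ord0 i) for i : 'I_n. *)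
Definition factor_perms : {set 'S_n} :=
  [set s : 'S_n |
    `[< forall i, isometric (Y (lift ord0 i)) (Y (lift ord0 (s i))) >]].

Lemma factor_perms_group_set : group_set factor_perms.
Proof.
apply/group_setP; split.
  rewrite inE; apply/asboolP => i; rewrite perm1.
  exact: inhabits (isometry_id _).
move=> s t; rewrite !inE => /asboolP hs /asboolP ht; apply/asboolP => i.
rewrite permM; have [f] := hs i; have [g] := ht (s i).
exact: inhabits (isometry_comp f g).
Qed.

Canonical factor_perms_group := Group factor_perms_group_set.
End FactorPermutations.

Section Fibres.
Variables (R : realType) (I : finType) (X : metricType R).
Variables (Y : I -> metricType R) (phi : isometric_bij X (l2prod Y)).

(* The Y_k-fibre through x of the decomposition phi. *)
Definition fibre (k : I) (x : X) : set X :=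
  [set x' | forall j, j != k -> phi x' j = phi x j].
End Fibres.

(* Main.v *)
(* For a base point o of a metric space, put
     gram o x y = (d(x,o)^2 + d(y,o)^2 - d(x,y)^2) / 2.
   The map x |-> gram o x embeds X into the vector space of functions on X, and
   a direct product decomposition of X becomes a decomposition into subspaces
   orthogonal for the (possibly indefinite) form given by gram.  Projections of
   X onto fibres become linear self-adjoint projections.

   Let E and F be the projections onto a factor A of one decomposition and onto
   a factor of another one, and let T = E F on A.  As E, F, 1 - E, 1 - F all
   come from maps of X, the set A is closed under (u, v) |-> v + T (u - v) and,
   with N = T (1 - T), under (u, v) |-> v + N (u - v) and
   (u, v) |-> v - N (u - v).  Hence A is invariant under all translations by
   N^2 (u - v).  Along a geodesic these form a one-parameter family, which would
   split off a line from A.  So if A is irreducible and not a line, then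
   N^2 = 0, hence N = 0 as the form is positive on A, hence E and F commute and
   A is the product of its intersections with both F-factors; by irreducibility
   A is contained in one of them.  Therefore an isometry of X permutes the
   non-Euclidean factors. *)
From HB Require Import structures.
Require Import Defs.
From mathcomp Require Import all_boot all_order all_algebra all_fingroup.
From mathcomp Require Import all_classical all_reals all_analysis.
From mathcomp Require Import ring lra.

Set Implicit Arguments.
Unset Strict Implicit.
Unset Printing Implicit Defensive.

Import Order.TTheory GRing.Theory Num.Theory.
Import numFieldNormedType.Exports.

Local Open Scope classical_set_scope.
Local Open Scope ring_scope.

(** * Subspaces, squared distances and irreducibility *)

Definition metric_subspace (R : realType) (M : metricType R) (S : set M) :
  Type := {x : M | x \in S}.

Section MetricSubspace.
Variables (R : realType) (M : metricType R) (S : set M).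
Implicit Types x y z : metric_subspace S.

HB.instance Definition _ := Choice.copy (metric_subspace S) {x : M | x \in S}.

Definition subspace_dist x y : R := mdist (val x) (val y).

Lemma subspace_distxx x : subspace_dist x x = 0.
Proof. exact: mdistxx. Qed.

Lemma subspace_dist_positivity x y : subspace_dist x y = 0 -> x = y.
Proof. by move=> /mdist_positivity /val_inj. Qed.

Lemma subspace_dist_sym x y : subspace_dist x y = subspace_dist y x.
Proof. exact: metric_sym. Qed.

Lemma subspace_dist_triangle y x z :
  subspace_dist x z <= subspace_dist x y + subspace_dist y z.
Proof. exact: metric_triangle. Qed.

HB.instance Definition _ := isMetric.Build R (metric_subspace S)
  subspace_distxx subspace_dist_positivity subspace_dist_sym
  subspace_dist_triangle.
End MetricSubspace.

Definition sqdist (R : realType) (X : metricType R) (x y : X) : R :=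
  mdist x y ^+ 2.

Section SquaredDistance.
Variables (R : realType) (X : metricType R).
Implicit Types x y z o : X.

Lemma sqdist_ge0 x y : 0 <= sqdist x y.
Proof. exact: sqr_ge0. Qed.

Lemma sqdistC x y : sqdist x y = sqdist y x.
Proof. by rewrite /sqdist metric_sym. Qed.

Lemma sqdistxx x : sqdist x x = 0.
Proof. by rewrite /sqdist mdistxx expr0n. Qed.

Lemma sqdist0_eq x y : sqdist x y = 0 -> x = y.
Proof. by move=> /eqP; rewrite sqrf_eq0 => /eqP /mdist_positivity. Qed.

Lemma mdist_sqdist x y : mdist x y = Num.sqrt (sqdist x y).
Proof. by rewrite sqrtr_sqr ger0_norm ?mdist_ge0. Qed.
End SquaredDistance.

(** Pythagoras makes the pair of maps an isometric embedding into the product of the two ranges, and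
    the rectangle condition makes it onto. Irreducibility can thus be used without building a
    product first. *)
Lemma irreducible_maps (R : realType) (Y M1 M2 : metricType R)
    (q1 : Y -> M1) (q2 : Y -> M2) :
  irreducible Y ->
  (forall y z, sqdist y z = sqdist (q1 y) (q1 z) + sqdist (q2 y) (q2 z)) ->
  (forall y z, exists x, q1 x = q1 y /\ q2 x = q2 z) ->
  (forall y z, q1 y = q1 z) \/ (forall y z, q2 y = q2 z).
Proof.
move=> irrY pyth rect.
have q1P y : q1 y \in range q1 by apply/mem_set; exists y.
have q2P y : q2 y \in range q2 by apply/mem_set; exists y.
pose Y1 : metricType R := metric_subspace (range q1).
pose Y2 : metricType R := metric_subspace (range q2).
pose h (y : Y) : l2pair Y1 Y2 :=
  (exist _ (q1 y) (q1P y), exist _ (q2 y) (q2P y)).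
have hd : isometric_embedding h.
  by move=> y z; rewrite [RHS]mdist_sqdist pyth.
have ho (w : l2pair Y1 Y2) : exists y, h y = w.
  case: w => -[a aP] [b bP].
  have [y _ ya] := set_mem aP; have [z _ zb] := set_mem bP.
  have [x [x1 x2]] := rect y z; exists x.
  by congr pair; apply: val_inj => /=; rewrite ?x1 ?x2.
have [[a a1]|[a a1]] := irrY Y1 Y2 (inhabits (IsometricBij hd ho)).
- left => y z.
  have e u : (exist _ (q1 u) (q1P u) : Y1) = a.
    have : [set: Y1] (exist _ (q1 u) (q1P u)) by [].
    by rewrite a1.
  by have := congr1 val (etrans (e y) (esym (e z))).
- right => y z.
  have e u : (exist _ (q2 u) (q2P u) : Y2) = a.
    have : [set: Y2] (exist _ (q2 u) (q2P u)) by [].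
    by rewrite a1.
  by have := congr1 val (etrans (e y) (esym (e z))).
Qed.

(** * The form [gram] and paths of constant speed *)

Definition gram (R : realType) (X : metricType R) (o x y : X) : R :=
  (sqdist x o + sqdist y o - sqdist x y) / 2.

Section Gram.
Variables (R : realType) (X : metricType R) (o : X).
Implicit Types x y z : X.

Lemma gramC x y : gram o x y = gram o y x.
Proof. by rewrite /gram (sqdistC y x) (addrC (sqdist x o)). Qed.

Lemma gram0l x : gram o o x = 0.
Proof. by rewrite /gram sqdistxx (sqdistC o) add0r subrr mul0r. Qed.

Lemma gram0r x : gram o x o = 0.
Proof. by rewrite gramC gram0l. Qed.

Lemma gramxx x : gram o x x = sqdist x o.
Proof. by rewrite /gram sqdistxx; field. Qed.

Lemma sqdist_gram x y :
  sqdist x y = gram o x x + gram o y y - 2 * gram o x y.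
Proof. by rewrite /gram !sqdistxx; field. Qed.

(** Evaluation at [x] and at [y] already gives distance 0. Equalities of points are later proved as
    equalities of the functions that represent them. *)
Lemma gram_inj x y : gram o x =1 gram o y -> x = y.
Proof.
move=> e; apply: sqdist0_eq; rewrite sqdist_gram.
by have := e x; have := e y; rewrite (gramC y x); lra.
Qed.
End Gram.

(** Projections of a geodesic to factors keep this property but not unit speed; [c] may be 0. *)
Definition constant_speed (R : realType) (X : metricType R) (c : R)
    (g : R -> X) : Prop :=
  {in `[0, 1] &, forall s t, mdist (g s) (g t) = c * `|s - t|}.

Lemma geodesic_constant_speed (R : realType) (X : metricType R) (x y : X) :
  geodesic X ->
  exists c g, [/\ constant_speed c g, g 0 = x & g 1 = y].
Proof.
move=> /(_ x y) [a [b [g [ab gd <- <-]]]].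
exists (b - a), (fun s => g (a + s * (b - a))); split; last 2 first.
- by rewrite mul0r addr0.
- by rewrite mul1r addrC subrK.
move=> s t; rewrite !in_itv /= => /andP[s0 s1] /andP[t0 t1].
rewrite gd ?in_itv /=; try by apply/andP; split; nra.
have -> : a + s * (b - a) - (a + t * (b - a)) = (b - a) * (s - t) by ring.
by rewrite normrM ger0_norm ?subr_ge0.
Qed.

(* Equality case of Minkowski's inequality in l^2 of dimension 2. *)
Lemma l2_triangle_eq (R : realType) (a1 a2 b1 b2 c1 c2 a b : R) :
  0 <= a1 -> 0 <= a2 -> 0 <= b1 -> 0 <= b2 -> 0 <= c1 -> 0 <= c2 ->
  0 <= a -> 0 <= b ->
  c1 <= a1 + b1 -> c2 <= a2 + b2 ->
  a ^+ 2 = a1 ^+ 2 + a2 ^+ 2 -> b ^+ 2 = b1 ^+ 2 + b2 ^+ 2 ->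
  (a + b) ^+ 2 = c1 ^+ 2 + c2 ^+ 2 ->
  c1 = a1 + b1 /\ a * b1 = b * a1.
Proof.
move=> a10 a20 b10 b20 c10 c20 a0 b0 c1l c2l ea eb ec.
have c1s : c1 ^+ 2 <= (a1 + b1) ^+ 2 by rewrite lerXn2r ?nnegrE ?addr_ge0.
have c2s : c2 ^+ 2 <= (a2 + b2) ^+ 2 by rewrite lerXn2r ?nnegrE ?addr_ge0.
have le1 : a * b <= a1 * b1 + a2 * b2 by nra.
(* Lagrange's identity: it gives the reverse of [le1], so both are equalities and the mixed term
   vanishes. *)
have lag : (a * b) ^+ 2 = (a1 * b1 + a2 * b2) ^+ 2 + (a1 * b2 - a2 * b1) ^+ 2.
  by rewrite exprMn ea eb; ring.
have le2 : (a1 * b1 + a2 * b2) ^+ 2 <= (a * b) ^+ 2.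
  by rewrite lag lerDl sqr_ge0.
have le3 : a1 * b1 + a2 * b2 <= a * b.
  by rewrite -ler_sqr ?nnegrE ?addr_ge0 ?mulr_ge0.
have e1 : a * b = a1 * b1 + a2 * b2 by lra.
have e2 : a1 * b2 - a2 * b1 = 0.
  by apply/eqP; rewrite -sqrf_eq0; apply/eqP; rewrite e1 in lag; lra.
have c1e : c1 ^+ 2 = (a1 + b1) ^+ 2 by nra.
split.
  by apply/eqP; rewrite -(@eqrXn2 _ 2) ?addr_ge0 //; apply/eqP.
apply/eqP; rewrite -(@eqrXn2 _ 2) ?mulr_ge0 //; apply/eqP.
rewrite !exprMn ea eb; have : a1 * b2 = a2 * b1 by lra.
move=> /(congr1 (fun x => x ^+ 2)); rewrite !exprMn; lra.
Qed.

(* A decomposition X = Y x Z is encoded by the operation sending (y, z) and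
   (y', z') to (y, z'); the fibres through o are then the fixed points of
   m _ o and of m o _. *)
Definition splitting (R : realType) (X : metricType R) (m : X -> X -> X) :
  Prop :=
  [/\ idempotent_op m,
      forall x y z, m (m x y) z = m x z,
      forall x y z, m x (m y z) = m x z &
      forall x y o,
        sqdist x y = sqdist (m x o) (m y o) + sqdist (m o x) (m o y)].

(** * Splittings as pairs of orthogonal projections *)

Section Splitting.
Variables (R : realType) (X : metricType R) (o : X) (m : X -> X -> X).
Hypothesis mS : splitting m.
Implicit Types x y z : X.

Lemma splitting_idem x : m x x = x. Proof. by case: mS. Qed.

Lemma splittingl x y z : m (m x y) z = m x z. Proof. by case: mS. Qed.

Lemma splittingr x y z : m x (m y z) = m x z. Proof. by case: mS. Qed.

Lemma splitting_flip : splitting (fun x y => m y x).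
Proof.
case: mS => idm ml mr pyth; split => //= x y p.
by rewrite (pyth x y p) addrC.
Qed.

Lemma gram_splitting x y :
  gram o x y = gram o (m x o) (m y o) + gram o (m o x) (m o y).
Proof.
case: mS => idm _ _ pyth; rewrite /gram (pyth x o o) (pyth y o o) (pyth x y o).
by rewrite !idm; field.
Qed.

Lemma gram_projl x y : gram o (m x o) y = gram o (m x o) (m y o).
Proof.
by rewrite gram_splitting splittingl splittingr splitting_idem gram0l addr0.
Qed.

(** Self-adjointness of the projection, since the two fibres through [o] are orthogonal for the
    form. *)
Lemma gram_proj x y : gram o (m x o) y = gram o x (m y o).
Proof. by rewrite gram_projl gramC -gram_projl gramC. Qed.
End Splitting.

Section SplittingMix.
Variables (R : realType) (X : metricType R) (o : X) (m : X -> X -> X).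
Hypothesis mS : splitting m.
Implicit Types x y z : X.

Lemma gram_coprojE x y : gram o (m o x) y = gram o x y - gram o x (m y o).
Proof.
rewrite (gram_splitting o mS x y) -(gram_projl o mS).
rewrite -(gram_projl o (splitting_flip mS)) (gram_proj o mS); ring.
Qed.

(** With E the projection [m _ o], the point [m x y] is represented by E x + (1 - E) y;
    self-adjointness moves E to the argument [z]. *)
Lemma gram_mix x y z :
  gram o (m x y) z = gram o x (m z o) + (gram o y z - gram o y (m z o)).
Proof.
rewrite (gram_splitting o mS) (splittingl mS) (splittingr mS).
rewrite -(gram_projl o mS) (gram_proj o mS); congr (_ + _).
by rewrite -(gram_projl o (splitting_flip mS)) gram_coprojE.
Qed.

(** Along [g] the triangle inequality is an equality, so the equality case of Minkowski makes the
    distances in the factor additive and proportional to those along [g]. *)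
Lemma constant_speed_proj c (g : R -> X) :
  constant_speed c g -> exists c', constant_speed c' (fun s => m (g s) o).
Proof.
move=> gc; pose d1 s t := mdist (m (g s) o) (m (g t) o).
pose d2 s t := mdist (m o (g s)) (m o (g t)).
have pyth s t : mdist (g s) (g t) ^+ 2 = d1 s t ^+ 2 + d2 s t ^+ 2.
  by case: mS => _ _ _ /(_ (g s) (g t) o).
have key r s t : 0 <= r -> r <= s -> s <= t -> t <= 1 ->
    d1 r t = d1 r s + d1 s t /\ c * (s - r) * d1 s t = c * (t - s) * d1 r s.
  move=> r0 rs st t1.
  have gE u v : 0 <= u -> u <= v -> v <= 1 -> mdist (g u) (g v) = c * (v - u).
    move=> u0 uv v1; rewrite gc ?in_itv /=; last 2 first.
    - by rewrite u0 (le_trans uv).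
    - by rewrite v1 (le_trans u0).
    by rewrite distrC ger0_norm ?subr_ge0.
  have e1 : mdist (g r) (g s) = c * (s - r) by apply: gE => //; lra.
  have e2 : mdist (g s) (g t) = c * (t - s) by apply: gE => //; lra.
  have e3 : mdist (g r) (g t) = c * (s - r) + c * (t - s).
    by rewrite gE //; [ring | lra].
  have := pyth r s; have := pyth s t; have := pyth r t; rewrite e1 e2 e3.
  move=> ec eb ea.
  by apply: (l2_triangle_eq _ _ _ _ _ _ _ _ _ _ ea eb ec);
    rewrite ?mdist_ge0 ?metric_triangle // -?e1 -?e2 mdist_ge0.
(* The proportionality in [key] carries a factor [c], which has to be cancelled. *)
have [c0|cn0] := eqVneq c 0.
  exists 0 => s t s01 t01; rewrite mul0r; apply/eqP.
  have := pyth s t; rewrite gc // c0 mul0r expr0n /= => /esym/eqP.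
  by rewrite paddr_eq0 ?sqr_ge0 // sqrf_eq0 => /andP[].
exists (d1 0 1).
have lin s t : 0 <= s -> s <= t -> t <= 1 -> d1 s t = d1 0 1 * (t - s).
  have lin0 u : 0 <= u -> u <= 1 -> d1 0 u = d1 0 1 * u.
    move=> u0 u1; have [-> e2] := key 0 u 1 (lexx _) u0 u1 (lexx _).
    have : u * d1 u 1 = (1 - u) * d1 0 u.
      by apply: (mulfI cn0); rewrite !mulrA -{1}(subr0 u).
    lra.
  move=> s0 st t1; have [e _] := key 0 s t (lexx _) s0 st t1.
  have st1 : s <= 1 by lra.
  have t0 : 0 <= t by lra.
  by move: e; rewrite (lin0 s) // (lin0 t) //; lra.
move=> s t; rewrite !in_itv /= => /andP[s0 s1] /andP[t0 t1].
have [st|/ltW ts] := leP s t.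
  by rewrite distrC ger0_norm ?subr_ge0 //; exact: lin.
by rewrite metric_sym ger0_norm ?subr_ge0 //; exact: lin.
Qed.
End SplittingMix.

(** * Translations along a path split off a line *)

Section TranslationLine.
Variables (R : realType) (Y : metricType R) (o : Y).
Implicit Types (x y z : Y) (v w : Y -> R).

(* Translating by v is possible in Y, in the space of functions on Y in which
   x is represented by gram o x. *)
Definition translation v : Prop :=
  forall x, exists x', forall z, gram o x' z = gram o x z + v z.

Lemma translationD v w :
  translation v -> translation w -> translation (fun z => v z + w z).
Proof.
move=> tv tw x; have [y yE] := tv x; have [x' x'E] := tw y.
by exists x' => z; rewrite x'E yE addrA.
Qed.

Lemma translationMn n v :
  translation v -> translation (fun z => n%:R * v z).
Proof.
move=> tv; elim: n => [|n IHn] x.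
  by exists x => z; rewrite mul0r addr0.
have [y yE] := IHn x; have [x' x'E] := tv y.
by exists x' => z; rewrite x'E yE -natr1; ring.
Qed.

Lemma translation_ext v w : v =1 w -> translation v -> translation w.
Proof. by move=> /funext ->. Qed.

Variables (g : R -> Y) (c : R).
Hypotheses (c_gt0 : 0 < c) (g_speed : constant_speed c g) (g0 : g 0 = o).
Hypothesis translation_g : {in `[0, 1], forall t, translation (gram o (g t))}.
Hypothesis translation_gN :
  {in `[0, 1], forall t, translation (fun z => - gram o (g t) z)}.

Let in01 (t : R) : 0 <= t -> t <= 1 -> t \in `[(0 : R), 1].
Proof. by move=> t0 t1; rewrite in_itv /= t0. Qed.

Let gramgg (s t : R) : s \in `[0, 1] -> t \in `[0, 1] ->
  gram o (g s) (g t) = c ^+ 2 * (s * t).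
Proof.
move=> s01 t01; have z01 : (0 : R) \in `[0, 1] by apply: in01; lra.
rewrite /gram -{1 2}g0 /sqdist !g_speed //.
by rewrite !exprMn -!normrX !ger0_norm ?sqr_ge0 //; field.
Qed.

(* The squared distance to o of the translate of x by e (n g(t) - m g(1)) is
   nonnegative. *)
Let defect_bound (t : R) n m x : t \in `[0, 1] ->
  `|n%:R * gram o (g t) x - m%:R * gram o (g 1) x| <=
    (gram o x x + c ^+ 2 * (n%:R * t - m%:R) ^+ 2) / 2.
Proof.
move=> t01; have o01 : (1 : R) \in `[0, 1] by apply: in01; lra.
have pos e : e * e = 1 ->
    translation
      (fun z => e * (n%:R * gram o (g t) z - m%:R * gram o (g 1) z)) ->
    0 <= gram o x x + 2 * (e * (n%:R * gram o (g t) x - m%:R * gram o (g 1) x))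
         + c ^+ 2 * (n%:R * t - m%:R) ^+ 2.
  move=> e1 /(_ x)[x' x'E].
  suff <- : gram o x' x' = gram o x x +
      2 * (e * (n%:R * gram o (g t) x - m%:R * gram o (g 1) x)) +
      c ^+ 2 * (n%:R * t - m%:R) ^+ 2 by rewrite gramxx sqdist_ge0.
  rewrite x'E (gramC o x) !(gramC _ _ x') !x'E !gramgg //.
  rewrite (gramC o x (g t)) (gramC o x (g 1)).
  transitivity (gram o x x +
      2 * (e * (n%:R * gram o (g t) x - m%:R * gram o (g 1) x)) +
      (e * e) * (c ^+ 2 * (n%:R * t - m%:R) ^+ 2)); first by ring.
  by rewrite e1 mul1r.
have p1 := pos 1 (mulr1 1); have pN := pos (-1) (etrans (mulrNN 1 1) (mulr1 1)).
rewrite ler_norml; apply/andP; split.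
  have : translation
      (fun z => 1 * (n%:R * gram o (g t) z - m%:R * gram o (g 1) z)).
    apply: translation_ext
      (translationD (translationMn n (translation_g t01))
                    (translationMn m (translation_gN o01))) => z /=.
    by ring.
  by move/p1; lra.
have : translation
    (fun z => -1 * (n%:R * gram o (g t) z - m%:R * gram o (g 1) z)).
  apply: translation_ext
    (translationD (translationMn n (translation_gN t01))
                  (translationMn m (translation_g o01))) => z /=.
  by ring.
by move/pN; lra.
Qed.

(** For [m] the integer part of [n t], the right side of [defect_bound] is bounded independently of
    [n]. Hence [n] times the deviation from linearity is bounded for all [n], and the deviation is
    0. *)
Let gram_linear (t : R) x : t \in `[0, 1] ->
  gram o (g t) x = t * gram o (g 1) x.
Proof.
move=> t01; apply/eqP; rewrite -subr_eq0 -normr_le0.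
set d := `| _ |; have d0 : 0 <= d by exact: normr_ge0.
rewrite leNgt; apply/negP => dgt.
pose K := (gram o x x + c ^+ 2) / 2 + `|gram o (g 1) x|.
have /andP[t0 t1] : 0 <= t <= 1 by rewrite in_itv in t01.
have bound n : n%:R * d <= K.
  have nt0 : 0 <= n%:R * t by rewrite mulr_ge0.
  have /andP[m1 m2] := truncn_itv nt0.
  set m := Num.truncn (n%:R * t) in m1 m2; rewrite -natr1 in m2.
  have b := defect_bound n m x t01.
  have -> : n%:R * d =
      `|(n%:R * gram o (g t) x - m%:R * gram o (g 1) x) -
        (n%:R * t - m%:R) * gram o (g 1) x|.
    by rewrite -[n%:R in LHS]ger0_norm ?ler0n // -normrM; congr `| _ |; ring.
  apply: le_trans (ler_normB _ _) _; apply: lerD.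
    apply: le_trans b _; rewrite ler_pM2r ?invr_gt0 // lerD2l.
    rewrite -[leRHS]mulr1 ler_wpM2l ?sqr_ge0 // expr_le1 //; lra.
  by rewrite normrM ger0_norm ?subr_ge0 // ler_piMl // lerBlDl ltW.
have := bound (Num.bound (K / d)).
rewrite -ler_pdivlMr // leNgt; apply/negP.
have K0 : 0 <= K.
  rewrite addr_ge0 // divr_ge0 // addr_ge0 ?sqr_ge0 //.
  by rewrite gramxx sqdist_ge0.
by rewrite negbK archi_boundP // divr_ge0.
Qed.

(** Integer multiples come from iterating the translation by [g 1]; the fractional part comes from a
    point of the path, by linearity. *)
Let translation_line r : translation (fun z => r * gram o (g 1) z).
Proof.
have o01 : (1 : R) \in `[0, 1] by apply: in01; lra.
have pos s : 0 <= s -> translation (fun z => s * gram o (g 1) z) /\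
    translation (fun z => - (s * gram o (g 1) z)).
  move=> s0; have /andP[m1 m2] := truncn_itv s0.
  set m := Num.truncn s in m1 m2; rewrite -natr1 in m2.
  have f01 : s - m%:R \in `[0, 1] by apply: in01; lra.
  split.
    apply: translation_ext
      (translationD (translationMn m (translation_g o01))
                    (translation_g f01)) => z /=.
    by rewrite (gram_linear _ f01); ring.
  apply: translation_ext
    (translationD (translationMn m (translation_gN o01))
                  (translation_gN f01)) => z /=.
  by rewrite (gram_linear _ f01); ring.
have [r0|/ltW r0] := leP 0 r; first by have [] := pos r r0.
rewrite -oppr_ge0 in r0; have [_] := pos _ r0.
by apply: translation_ext => z; rewrite mulNr opprK.
Qed.

(** [b] is the coordinate along [g 1], and [h] removes that coordinate. Translations change [b]
    freely and keep [h], so [Y] is a line times the range of [h]; as [b] is not constant, [h] is. *)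
Lemma irreducible_line : irreducible Y -> isometric Y (R^o : metricType R).
Proof.
move=> irrY; have o01 : (1 : R) \in `[0, 1] by apply: in01; lra.
have cn0 : c != 0 by rewrite gt_eqF.
have g11 : gram o (g 1) (g 1) = c ^+ 2 by rewrite gramgg // !mulr1.
pose b x : R^o := gram o (g 1) x / c.
have hP x : {x' | forall z, gram o x' z =
    gram o x z - b x / c * gram o (g 1) z}.
  have [x' x'E] := cid (translation_line (- (b x / c)) x).
  by exists x' => z; rewrite x'E mulNr.
pose h x := sval (hP x).
have hE x z : gram o (h x) z = gram o x z - b x / c * gram o (g 1) z.
  exact: (svalP (hP x)).
have bh x : b (h x) = 0.
  by rewrite /b gramC hE gramC g11 /b; field.
have bd x y : sqdist (b x) (b y) = (b x - b y) ^+ 2.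
  rewrite -sqrrN opprB; transitivity (`|b y - b x| ^+ 2) => //.
  by rewrite -normrX ger0_norm ?sqr_ge0.
have hd x y : gram o (h x) (h y) = gram o x y - b x * b y.
  rewrite hE (gramC o x) hE -[gram o (g 1) (h y)](divfK cn0) -/(b (h y)) bh.
  by rewrite (gramC o y) /b; field.
have b_onto y r : exists x, b x = b y + r /\ h x = h y.
  have [x xE] := translation_line (r / c) y.
  have bx : b x = b y + r by rewrite /b gramC xE gramC g11; field.
  exists x; split => //; apply: (@gram_inj _ _ o) => z.
  by rewrite !hE xE bx; field.
have pyth x y : sqdist x y = sqdist (b x) (b y) + sqdist (h x) (h y).
  by rewrite bd !(sqdist_gram o) !hd; ring.
have rect y z : exists x, b x = b y /\ h x = h z.
  have [x [bx hx]] := b_onto z (b y - b z).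
  by exists x; rewrite bx hx addrC subrK.
have [b_const|h_const] := irreducible_maps irrY pyth rect.
  have := b_const o (g 1); rewrite /b gram0r g11 mul0r => /esym/eqP.
  by rewrite mulf_eq0 sqrf_eq0 invr_eq0 orbb (negPf cn0).
apply: inhabits; apply: (@IsometricBij _ _ _ (b : Y -> R^o)) => [x y|r].
  by rewrite !mdist_sqdist pyth (h_const x y) sqdistxx addr0.
have [x [bx _]] := b_onto o r; exists x; rewrite bx /b gram0r mul0r.
by rewrite add0r.
Qed.
End TranslationLine.

(** * Translations of a factor that come from two splittings *)

Lemma gram_isometric (R : realType) (X Y : metricType R) (f : Y -> X) o y z :
  isometric_embedding f -> gram (f o) (f y) (f z) = gram o y z.
Proof. by move=> fd; rewrite /gram /sqdist !fd. Qed.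

(** If [w] moved [a], it would carry a geodesic from [o] to [a] to a path of positive constant speed
    in [Y], with translations along it in both directions; then [Y] would be a line. *)
Lemma no_translation_path (R : realType) (X Y : metricType R)
    (iota : Y -> X) (oY : Y) (w : X -> X) :
  let o := iota oY in
  geodesic X -> isometric_embedding iota -> irreducible Y ->
  ~ isometric Y (R^o : metricType R) ->
  (forall c g, constant_speed c g ->
     exists c', constant_speed c' (fun s : R => w (g s))) ->
  w o = o -> (forall x, exists y, iota y = w x) ->
  (forall x y, exists y', forall z,
     gram o (iota y') z = gram o (iota y) z + gram o (w x) z) ->
  (forall x y, exists y', forall z,
     gram o (iota y') z = gram o (iota y) z - gram o (w x) z) ->
  forall x, w x = o.
Proof.
move=> o X_geodesic iota_dist irrY nline speed wo wY tr trN a.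
apply: contrapT => an0; apply: nline.
have [c0 [g0 [/speed[c gc] g00 g01]]] := geodesic_constant_speed o a X_geodesic.
pose g s := sval (cid (wY (g0 s))).
have gE s : iota (g s) = w (g0 s) by exact: (svalP (cid (wY (g0 s)))).
apply: (@irreducible_line _ _ oY g c) => //.
- have -> : c = mdist o (w a).
    have := gc 0 1; rewrite g00 g01 wo sub0r normrN normr1 mulr1 => ->//;
      by rewrite in_itv /= lexx ler01.
  by rewrite mdist_gt0; apply/eqP => oa; apply: an0.
- by move=> s t s01 t01; rewrite -iota_dist !gE gc.
- by apply: mdist_positivity; rewrite -iota_dist gE g00 wo mdistxx.
- move=> t t01 y; have [y' y'E] := tr (g0 t) y; exists y' => z.
  by rewrite -!(gram_isometric oY _ _ iota_dist) y'E gE.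
- move=> t t01 y; have [y' y'E] := trN (g0 t) y; exists y' => z.
  by rewrite -!(gram_isometric oY _ _ iota_dist) y'E gE.
Qed.

(* Let E and F be the operators u |-> u \o P and u |-> u \o Q on functions on
   X, T = E F, and A the set of all gram o x with P x = x.  Then T and
   N = T - T^2 act on A as below; the crucial case is -N = E F (1 - E) (1 - F),
   which reverses directions. *)
Section TwoSplittings.
Variables (R : realType) (X : metricType R) (o : X) (m1 m2 : X -> X -> X).
Hypotheses (m1S : splitting m1) (m2S : splitting m2).
Implicit Types x y z a b p : X.

Let k := gram o.
Let P x := m1 x o.
Let Q x := m2 x o.

Let kP x z : k (P x) z = k x (P z). Proof. exact: gram_proj. Qed.
Let kQ x z : k (Q x) z = k x (Q z). Proof. exact: gram_proj. Qed.
Let kPc x z : k (m1 o x) z = k x z - k x (P z). Proof. exact: gram_coprojE. Qed.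
Let kQc x z : k (m2 o x) z = k x z - k x (Q z). Proof. exact: gram_coprojE. Qed.

Let kmix1 x y z : k (m1 x y) z = k x (P z) + (k y z - k y (P z)).
Proof. exact: gram_mix. Qed.
Let kmix2 x y z : k (m2 x y) z = k x (Q z) + (k y z - k y (Q z)).
Proof. exact: gram_mix. Qed.

Let PP x : P (P x) = P x. Proof. by rewrite /P (splittingl m1S). Qed.
Let QQ x : Q (Q x) = Q x. Proof. by rewrite /Q (splittingl m2S). Qed.
Let Po : P o = o. Proof. exact: splitting_idem m1S o. Qed.
Let Qo : Q o = o. Proof. exact: splitting_idem m2S o. Qed.

Let fixP x : P x = x <-> forall z, k x (P z) = k x z.
Proof.
split=> [xP z|kx]; first by rewrite -kP xP.
by apply: (@gram_inj _ _ o) => z; rewrite -/k kP kx.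
Qed.

Let move_T x y : P x = x -> P y = y ->
  exists2 p, P p = p &
    forall z, k p z = k y z + (k x (Q (P z)) - k y (Q (P z))).
Proof.
(* The witness is E (F x + (1 - F) y) + (1 - E) y = y + T (x - y). On functions, T u sends [z] to u
   at [Q (P z)]. *)
move=> /fixP kx /fixP ky; exists (m1 (m2 x y) y).
  by apply/fixP => z; rewrite !kmix1 PP ky; ring.
by move=> z; rewrite kmix1 !kmix2 !ky; ring.
Qed.

Let move_N x y : P x = x -> P y = y ->
  exists2 p, P p = p &
    forall z, k p z = k y z + (k x (Q (P z)) - k y (Q (P z)))
      - (k x (Q (P (Q (P z)))) - k y (Q (P (Q (P z))))).
Proof.
(* Two moves: p1 = x + T (y - x), then p = y + T (p1 - y) = y + (T - T^2) (x - y). *)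
move=> xP yP; have [p1 p1P p1E] := move_T yP xP.
have [p pP pE] := move_T p1P yP.
by exists p => // z; rewrite pE !p1E; ring.
Qed.

Let move_oppN x y : P x = x -> P y = y ->
  exists2 p, P p = p &
    forall z, k p z = k y z - (k x (Q (P z)) - k y (Q (P z)))
      + (k x (Q (P (Q (P z)))) - k y (Q (P (Q (P z))))).
Proof.
move=> /fixP kx /fixP ky.
(* From the inside out, the four operations apply 1 - F, 1 - E, F and E to x - y, always relative to
   y. *)
exists (m1 (m2 (m1 y (m2 y x)) y) y).
  by apply/fixP => z; rewrite !kmix1 PP ky; ring.
move=> z; rewrite kmix1 kmix2 kmix1 !kmix2 !QQ !ky !kx.
by rewrite -(kx (Q (P (Q (P z))))) -(ky (Q (P (Q (P z))))) !kx !ky; ring.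
Qed.

Let move_N2 x a b : P x = x -> P a = a -> P b = b ->
  exists2 p, P p = p & forall z, let t y := Q (P y) in
    k p z = k x z + (k a (t (t z)) - k b (t (t z)))
      - 2 * (k a (t (t (t z))) - k b (t (t (t z))))
      + (k a (t (t (t (t z)))) - k b (t (t (t (t z))))).
Proof.
(* Here p = x + T N (x - b) and q = x + (1 - T) N (a - x). In r = T q + (1 - T) p the terms in x
   cancel, which leaves x + N^2 (a - b). *)
move=> xP aP bP; have [p0 p0P p0E] := move_oppN bP xP.
have [p pP pE] := move_T p0P xP.
have [q0 q0P q0E] := move_N aP xP.
have [q qP qE] := move_T xP q0P.
have [r rP rE] := move_T qP pP.
by exists r => // z /=; rewrite rE !qE !pE !q0E !p0E; ring.
Qed.

(** On A this is N, as E F E (1 - F) agrees there with T - T^2. As a composite of projections it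
    maps points to points and preserves constant speed. *)
Let n x := P (Q (P (m2 o x))).

Let n_fixed x : P (n x) = n x. Proof. exact: PP. Qed.

Let nE x z : P x = x -> k (n x) z = k x (Q (P z)) - k x (Q (P (Q (P z)))).
Proof. by move=> /fixP kx; rewrite /n kP kQ kP kQc kx. Qed.

Let n2E x z : P x = x -> let t y := Q (P y) in
  k (n (n x)) z = k x (t (t z)) - 2 * k x (t (t (t z)))
    + k x (t (t (t (t z)))).
Proof. by move=> xP /=; rewrite nE // !nE //; ring. Qed.

Variables (Y : metricType R) (iota : Y -> X) (oY : Y).
Hypotheses (iota_dist : isometric_embedding iota) (iota_o : iota oY = o).
Hypothesis iotaP : forall x, P x = x <-> exists y : Y, iota y = x.
Hypotheses (X_geodesic : geodesic X) (irrY : irreducible Y).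
Hypothesis Y_not_line : ~ isometric Y (R^o : metricType R).

Let iota_fixed (y : Y) : P (iota y) = iota y.
Proof. by apply/iotaP; exists y. Qed.

(** [move_N2] with one of its two points equal to [o] provides the translations by N^2 x and by its
    negative, so [no_translation_path] applies to N^2 after [P]. *)
Let n2_eq0 x : P x = x -> n (n x) = o.
Proof.
move=> xP; rewrite -{1}xP -iota_o.
apply: (no_translation_path (w := fun x => n (n (P x)))) => //= {x xP}.
- have nspeed c g : constant_speed c g ->
      exists c', constant_speed c' (fun s : R => n (g s)).
    move=> /(constant_speed_proj o (splitting_flip m2S))[c1].
    move=> /(constant_speed_proj o m1S)[c2].
    move=> /(constant_speed_proj o m2S)[c3].
    by move=> /(constant_speed_proj o m1S).
  move=> c g /(constant_speed_proj o m1S)[c1] /nspeed[c2] /nspeed[c3] ?.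
  by exists c3.
- have no : n o = o by rewrite /n (splitting_idem m2S) Po Qo Po.
  by rewrite iota_o Po !no.
- by move=> x; apply/iotaP; exact: n_fixed.
- move=> x y; have [q /iotaP[y' <-] qE] := move_N2 (iota_fixed y) (PP x) Po.
  by exists y' => z; rewrite iota_o -/k qE n2E // /k !gram0l; ring.
- move=> x y; have [q /iotaP[y' <-] qE] := move_N2 (iota_fixed y) Po (PP x).
  by exists y' => z; rewrite iota_o -/k qE n2E // /k !gram0l; ring.
Qed.

(* N is self-adjoint for the form, which is positive on A. *)
Let n_eq0 x : P x = x -> n x = o.
Proof.
move=> xP; have yP := n_fixed x; set y := n x in yP *.
apply: sqdist0_eq; rewrite -gramxx -/k nE // yP.
suff -> : k x (Q y) - k x (Q (P (Q y))) = k (n y) x.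
  by rewrite n2_eq0 // /k gram0l.
rewrite nE // xP /k !(gramC o y) -/k.
by rewrite !(kQ, kP).
Qed.

(** By self-adjointness the squared length of (1 - E) F x is the value of N x at x, which is 0; so F
    maps A into itself. *)
Let projQ_fixed x : P x = x -> P (Q x) = Q x.
Proof.
move=> xP; have kx := (fixP x).1 xP.
suff e : m1 o (Q x) = o.
  apply: (@gram_inj _ _ o) => z; apply/esym/eqP.
  by rewrite -subr_eq0 -/k kP -kPc e /k gram0l.
apply: sqdist0_eq; rewrite -gramxx -/k; set p := m1 o (Q x).
have pP : P p = o by rewrite /p /P (splittingl m1S) (splitting_idem m1S).
have -> : k p p = k x (Q x) - k x (Q (P (Q x))).
  rewrite {1}/p kPc pP !kQ Qo [k x o]gram0r subr0 -[k x (Q p)]kQ.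
  by rewrite [LHS]gramC -/k /p kPc !kQ QQ.
by have := nE x xP; rewrite n_eq0 // xP /k gram0l.
Qed.

(** Since F preserves A, so does 1 - F, and A is the product of its images under both;
    irreducibility makes one image a point. *)
Lemma splitting_dichotomy :
  (forall y : Y, m2 (iota y) o = o) \/ (forall y : Y, m2 (iota y) o = iota y).
Proof.
have pyth (y z : Y) : sqdist y z = sqdist (Q (iota y)) (Q (iota z)) +
    sqdist (m2 o (iota y)) (m2 o (iota z)).
  by case: m2S => _ _ _ /(_ (iota y) (iota z) o) <-; rewrite /sqdist iota_dist.
have rect (y z : Y) : exists x : Y, Q (iota x) = Q (iota y) /\
    m2 o (iota x) = m2 o (iota z).
  pose x := m2 (iota y) (iota z).
  have /iotaP[y' y'E] : P x = x.
    have ky := (fixP _).1 (projQ_fixed (iota_fixed y)).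
    have kz' := (fixP _).1 (projQ_fixed (iota_fixed z)).
    have kz := (fixP _).1 (iota_fixed z).
    by apply/fixP => w; rewrite !kmix2 -!kQ ky kz kz'.
  by exists y'; rewrite y'E /Q /x (splittingl m2S) (splittingr m2S).
have [Q_const|Qc_const] := irreducible_maps irrY pyth rect.
  by left => y; rewrite -/(Q (iota y)) (Q_const y oY) iota_o Qo.
right => y; apply: (@gram_inj _ _ o) => z; rewrite -/k.
have := kQc (iota y) z.
rewrite (Qc_const y oY) iota_o (splitting_idem m2S) [k o z]gram0l.
by rewrite -/(Q (iota y)) kQ; lra.
Qed.
End TwoSplittings.

(** * Coordinates and fibres of a finite product *)

Section Coordinates.
Variables (R : realType) (I : finType) (X : metricType R).
Variables (Y : I -> metricType R) (phi : isometric_bij X (l2prod Y)).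
Implicit Types (x y z o : X) (i j : I).

Definition fibre_embedding i o (u : Y i) : X :=
  isometry_preimage phi (dfwith (phi o : forall j, Y j) i u).

Definition fibre_mix i x y : X := fibre_embedding y (phi x i).

Lemma fibre_embedding_in i o (u : Y i) : phi (fibre_embedding o u) i = u.
Proof. by rewrite /fibre_embedding isometry_preimageK dfwithin. Qed.

Lemma fibre_embedding_out i o (u : Y i) j :
  j != i -> phi (fibre_embedding o u) j = phi o j.
Proof.
by move=> ji; rewrite /fibre_embedding isometry_preimageK dfwithout // eq_sym.
Qed.

Lemma coord_inj x y : (forall i, phi x i = phi y i) -> x = y.
Proof.
move=> e; rewrite -(isometryK phi x) -(isometryK phi y).
congr isometry_preimage.
exact: functional_extensionality_dep.
Qed.

Lemma fibre_embedding_id i o : fibre_embedding o (phi o i) = o.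
Proof.
apply: coord_inj => j; have [->|ji] := eqVneq j i.
  exact: fibre_embedding_in.
exact: fibre_embedding_out.
Qed.

Lemma sqdist_coord x y : sqdist x y = \sum_i sqdist (phi x i) (phi y i).
Proof.
rewrite /sqdist -(isometry_dist phi) [mdist _ _]/(l2dist _ _) sqr_sqrtr //.
by apply: sumr_ge0 => i _; exact: sqr_ge0.
Qed.

Lemma sqdist_coord1 i x y : (forall j, j != i -> phi x j = phi y j) ->
  sqdist x y = sqdist (phi x i) (phi y i).
Proof.
move=> e; rewrite sqdist_coord (bigD1 i) //= big1 ?addr0 // => j ji.
by rewrite e // sqdistxx.
Qed.

Lemma fibre_embedding_dist i o : isometric_embedding (@fibre_embedding i o).
Proof.
move=> u v; rewrite !mdist_sqdist (@sqdist_coord1 i).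
  by rewrite !fibre_embedding_in.
by move=> j ji; rewrite !fibre_embedding_out.
Qed.

Lemma fibre_mix_in i x y : phi (fibre_mix i x y) i = phi x i.
Proof. exact: fibre_embedding_in. Qed.

Lemma fibre_mix_out i x y j : j != i -> phi (fibre_mix i x y) j = phi y j.
Proof. exact: fibre_embedding_out. Qed.

Lemma fibre_mix_splitting i : splitting (fibre_mix i).
Proof.
split.
- by move=> x; exact: fibre_embedding_id.
- by move=> x y z; rewrite {1}/fibre_mix fibre_mix_in.
- move=> x y z; apply: coord_inj => j; have [->|ji] := eqVneq j i.
    by rewrite !fibre_mix_in.
  by rewrite !fibre_mix_out.
move=> x y o; rewrite [in RHS](@sqdist_coord1 i); last first.
  by move=> j ji; rewrite !fibre_mix_out.
rewrite !fibre_mix_in !sqdist_coord (bigD1 i) //=; congr (_ + _).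
rewrite [RHS](bigD1 i) //= !fibre_mix_in sqdistxx add0r.
by apply: eq_bigr => j ji; rewrite !fibre_mix_out.
Qed.

Lemma fibre_mix_fixed i o x :
  fibre_mix i x o = x <-> exists u : Y i, fibre_embedding o u = x.
Proof.
split=> [e|[u <-]]; first by exists (phi x i).
by rewrite /fibre_mix fibre_embedding_in.
Qed.

Lemma gram_coord o x y : gram o x y = \sum_i gram (phi o i) (phi x i) (phi y i).
Proof.
rewrite /gram !sqdist_coord -big_split -sumrB mulr_suml.
by apply: eq_bigr.
Qed.

Lemma gram_fibre_embedding i o (u : Y i) y :
  gram o (fibre_embedding o u) y = gram (phi o i) u (phi y i).
Proof.
rewrite gram_coord (bigD1 i) //= big1 ?addr0 ?fibre_embedding_in // => j ji.
by rewrite fibre_embedding_out // gram0l.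
Qed.

Lemma gram_fibre_mix i o x y :
  gram o (fibre_mix i x o) y = gram (phi o i) (phi x i) (phi y i).
Proof. exact: gram_fibre_embedding. Qed.

Lemma coord_eqE i o x y :
  phi x i = phi y i <-> fibre_mix i x o = fibre_mix i y o.
Proof.
split=> [|e]; first by rewrite /fibre_mix => ->.
by rewrite -(fibre_mix_in i x o) e fibre_mix_in.
Qed.
End Coordinates.

(** * Translations of Euclidean space *)

Section Euclidean.
Variable R : realType.

Lemma gram_l2prod_real k (o x y : l2prod (fun _ : 'I_k => R^o : metricType R)) :
  gram o x y = \sum_i (x i - o i) * (y i - o i).
Proof.
have sqE (u v : R^o) : sqdist u v = (u - v) ^+ 2.
  rewrite -sqrrN opprB; transitivity (`|v - u| ^+ 2) => //.
  by rewrite -normrX ger0_norm ?sqr_ge0.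
rewrite (gram_coord (isometry_id _)); apply: eq_bigr => i _ /=.
by rewrite /gram !sqE; field.
Qed.

Lemma euclidean_translation (E : metricType R) (o a b : E) : euclidean E ->
  exists p q, forall z, gram o p z = gram o a z + gram o b z /\
                        gram o q z = gram o a z - gram o b z.
Proof.
move=> [k [e]].
have eG x y : gram o x y = gram (e o) (e x) (e y).
  by rewrite gram_isometric //; exact: isometry_dist.
(* The sum and the difference of the vectors from [o] to [a] and from [o] to [b], attached at
   [o]. *)
exists (isometry_preimage e (fun i => e a i + e b i - e o i)).
exists (isometry_preimage e (fun i => e a i - e b i + e o i)) => z.
rewrite !eG !isometry_preimageK !gram_l2prod_real -big_split -sumrB /=.
by split; apply: eq_bigr => i _; ring.
Qed.
End Euclidean.

(** * Matching the factors of two decompositions *)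

Section Matching.
Variables (R : realType) (X : metricType R) (n : nat).
Variable Y : 'I_n.+1 -> metricType R.
Hypotheses (X_geodesic : geodesic X) (Y0_euclidean : euclidean (Y ord0)).
Hypothesis Y_irreducible : forall k : 'I_n, irreducible (Y (lift ord0 k)).
Hypothesis Y_not_line :
  forall k : 'I_n, ~ isometric (Y (lift ord0 k)) (R^o : metricType R).
Hypothesis Y_not_point : forall k : 'I_n, ~ is_point (Y (lift ord0 k)).
Implicit Types (phi psi : isometric_bij X (l2prod Y)) (o x : X) (k : 'I_n).

Let P phi o i x := fibre_mix phi i x o.

Lemma exists_off_base phi o k :
  exists u : Y (lift ord0 k), fibre_embedding phi o u <> o.
Proof.
apply: contrapT => /forallNP trivial; apply: (Y_not_point (k := k)).
exists (phi o (lift ord0 k)); apply/seteqP; split => // u _ /=.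
by rewrite -(fibre_embedding_in phi o u) (contrapT (trivial u)).
Qed.

(** Each projection of [psi] either collapses the fibre or fixes it pointwise. They cannot all
    collapse it, and the Euclidean one cannot fix it. *)
Lemma fibre_in_fibre phi psi o k : exists l : 'I_n, forall x,
  P psi o (lift ord0 l) (P phi o (lift ord0 k) x) = P phi o (lift ord0 k) x.
Proof.
set i := lift ord0 k; pose iota := fibre_embedding phi o : Y i -> X.
have iota_o : iota (phi o i) = o by exact: fibre_embedding_id.
have iota_dist : isometric_embedding iota by exact: fibre_embedding_dist.
have dicho j := splitting_dichotomy (fibre_mix_splitting phi i)
  (fibre_mix_splitting psi j) iota_dist iota_o (fibre_mix_fixed phi i o)
  X_geodesic (@Y_irreducible k) (@Y_not_line k).
have [[j jP]|nall] := pselect (exists j, forall u, P psi o j (iota u) = iota u).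
  have [l jl|j0] := unliftP ord0 j.
    by exists l => x; rewrite -jl; exact: jP.
  (* A fibre inside the Euclidean factor would be closed under addition and subtraction, hence would
     admit translations along itself. *)
  exfalso; rewrite {j}j0 in jP.
  have [u un0] := exists_off_base phi o k; apply: un0.
  have jG v z : gram o (iota v) z =
      gram (psi o ord0) (psi (iota v) ord0) (psi z ord0).
    by rewrite -{1}(jP v) gram_fibre_mix.
  have translate v w : exists p q, forall z,
      gram o (iota p) z = gram o (iota v) z + gram o (iota w) z /\
      gram o (iota q) z = gram o (iota v) z - gram o (iota w) z.
    have [p [q pq]] := euclidean_translation (psi o ord0) (psi (iota v) ord0)
      (psi (iota w) ord0) Y0_euclidean.
    have iG v' z : gram o (iota v') (P phi o i z) = gram o (iota v') z.
      rewrite -(gram_proj o (fibre_mix_splitting phi i)).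
      by rewrite ((fibre_mix_fixed phi i o _).2 (ex_intro _ v' erefl)).
    (* A point of the Euclidean fibre whose function is invariant under the projection to the
       [phi]-fibre lies in that fibre, by self-adjointness. *)
    have lift_i (r : Y ord0) (G : X -> R) :
        (forall z, gram o (fibre_embedding psi o r) z = G z) ->
        (forall z, G (P phi o i z) = G z) ->
        exists v', iota v' = fibre_embedding psi o r.
      move=> rG GP; apply/fibre_mix_fixed; apply: (gram_inj (o := o)) => z.
      by rewrite (gram_proj o (fibre_mix_splitting phi i)) !rG GP.
    have [] := lift_i p (fun z => gram o (iota v) z + gram o (iota w) z).
    - by move=> z; rewrite gram_fibre_embedding (pq _).1 !jG.
    - by move=> z; rewrite !iG.
    move=> p' p'E.
    have [] := lift_i q (fun z => gram o (iota v) z - gram o (iota w) z).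
    - by move=> z; rewrite gram_fibre_embedding (pq _).2 !jG.
    - by move=> z; rewrite !iG.
    move=> q' q'E; exists p', q' => z.
    by rewrite p'E q'E !jG !gram_fibre_embedding (pq _).1 (pq _).2.
  have := no_translation_path (iota := iota) (oY := phi o i) (w := P phi o i).
  rewrite /= iota_o => /(_ X_geodesic iota_dist (@Y_irreducible k)).
  move=> /(_ (@Y_not_line k)) const.
  suff : P phi o i (iota u) = o.
    by rewrite /P ((fibre_mix_fixed phi i o _).2 (ex_intro _ u erefl)).
  apply: const.
  - move=> c g; exact: (constant_speed_proj o (fibre_mix_splitting phi i)).
  - exact: (splitting_idem (fibre_mix_splitting phi i)).
  - by move=> x; exists (phi x i).
  - move=> x v; have [p [q pq]] := translate v (phi x i).
    by exists p => z; have [] := pq z.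
  - move=> x v; have [p [q pq]] := translate v (phi x i).
    by exists q => z; have [] := pq z.
exfalso; have [u un0] := exists_off_base phi o k; apply: un0.
apply: (coord_inj (phi := psi)) => j.
rewrite (coord_eqE psi j o).
have [->|jfix] := dicho j.
  by rewrite (splitting_idem (fibre_mix_splitting psi j)).
by exfalso; apply: nall; exists j.
Qed.

(* Projections onto the same fibre agree, as both are self-adjoint for gram. *)
Lemma coordinate_matching phi psi o : exists s : 'S_n,
  forall j x, P phi o j x = P psi o (lift_perm ord0 ord0 s j) x.
Proof.
have [s sP] := choice (fibre_in_fibre phi psi o).
have [t tP] := choice (fibre_in_fibre psi phi o).
have ts k : t (s k) = k.
  (* Otherwise the fibre of index [k] lies in another fibre of [phi] through [o], and the two meet
     only in [o]. *)
  apply/eqP/negPn/negP => tsk.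
  have [u un0] := exists_off_base phi o k; apply: un0.
  pose x := fibre_embedding phi o u.
  have xP : P phi o (lift ord0 k) x = x by apply/fibre_mix_fixed; exists u.
  have xQ := sP k x; rewrite xP in xQ.
  have e := tP (s k) x; rewrite xQ in e.
  rewrite -/x -e; apply: (coord_inj (phi := phi)) => j.
  have [->|jts] := eqVneq j (lift ord0 (t (s k))).
    by rewrite fibre_mix_in fibre_embedding_out.
  by rewrite fibre_mix_out.
have adj i := gram_proj o (fibre_mix_splitting phi i).
have adj' i := gram_proj o (fibre_mix_splitting psi i).
have match_lift k x : P phi o (lift ord0 k) x = P psi o (lift ord0 (s k)) x.
  apply: (gram_inj (o := o)) => y; rewrite -sP.
  have := tP (s k) y; rewrite ts /P => PQ.
  by rewrite adj' adj PQ adj'.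
exists (perm (can_inj ts)) => j x.
have [k ->|->] := unliftP ord0 j; first by rewrite lift_perm_lift permE.
(* The form is the sum over the coordinates for [phi] and for [psi]; cancelling the matched summands
   leaves those of index 0. *)
rewrite lift_perm_id; apply: (gram_inj (o := o)) => z.
rewrite !gram_fibre_mix; pose F (chi : isometric_bij X (l2prod Y)) i :=
  gram (chi o i) (chi x i) (chi z i).
have e : \sum_i F phi i = \sum_i F psi i by rewrite -!gram_coord.
have e' : \sum_k F phi (lift ord0 k) = \sum_k F psi (lift ord0 k).
  rewrite [RHS](reindex_perm (perm (can_inj ts))) /=.
  apply: eq_bigr => k _; rewrite permE /F -!gram_fibre_mix.
  by congr gram; exact: match_lift.
by move: e; rewrite !big_ord_recl e' => /addIr.
Qed.
End Matching.

(** * Isometries that permute the factors *)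

Lemma multiplicative_of_morph (G H : groupType) (f : G -> H) :
  (forall x y, f (x * y)%g = (f x * f y)%g) ->
  exists h : {multiplicative G -> H}, h = f :> (G -> H).
Proof.
move=> fM; pose h : {multiplicative G -> H} :=
  HB.pack f (isMultiplicative.Build G H f fM).
by exists h.
Qed.

(** The empty space is isometric to its own square and is not a point. Nonempty factors will provide
    a base point of [X]. *)
Lemma irreducible_nonempty (R : realType) (Y : metricType R) :
  irreducible Y -> exists y : Y, True.
Proof.
move=> irrY; apply: contrapT => noY.
have h : isometric Y (l2pair Y Y).
  apply: inhabits.
  apply: (@IsometricBij _ _ (l2pair Y Y) (fun y => (y, y))) => y.
    by exfalso; apply: noY; exists y.
  by exfalso; apply: noY; exists y.1.
by have [] := irrY _ _ h => -[y _]; apply: noY; exists y.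
Qed.

Lemma euclidean_nonempty (R : realType) (Y : metricType R) :
  euclidean Y -> exists y : Y, True.
Proof. by move=> [k [e]]; exists (isometry_preimage e (fun=> 0)). Qed.

Section Factors.
Variables (R : realType) (I : finType) (X : metricType R).
Variables (Y : I -> metricType R) (phi : isometric_bij X (l2prod Y)).
Implicit Types (f : Iso X) (x y : X) (i j : I).

(** The first condition makes the induced map of coordinates well defined. By the second, [f] maps
    fibres into fibres, where the distance is that of a single coordinate. *)
Lemma factor_isometry f i j :
  X -> (forall x y, phi x i = phi y i -> phi (f x) j = phi (f y) j) ->
  (forall x y, (forall l, l != i -> phi x l = phi y l) ->
     forall l, l != j -> phi (f x) l = phi (f y) l) ->
  exists h : isometric_bij (Y i) (Y j), forall x, phi (f x) j = h (phi x i).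
Proof.
move=> o coord fib; pose h (u : Y i) := phi (f (fibre_embedding phi o u)) j.
have hE x : phi (f x) j = h (phi x i).
  by apply: coord; rewrite fibre_embedding_in.
have hd : isometric_embedding h.
  move=> u v; rewrite !mdist_sqdist -(sqdist_coord1 (phi := phi)).
    rewrite /sqdist isometry_dist -/(sqdist _ _).
    rewrite (sqdist_coord1 (phi := phi) (i := i)).
      by rewrite !fibre_embedding_in.
    by move=> l li; rewrite !fibre_embedding_out.
  by apply: fib => l li; rewrite !fibre_embedding_out.
have ho v : exists u, h u = v.
  have [x fx] := isometry_onto f (fibre_embedding phi o v).
  by exists (phi x i); rewrite -hE fx fibre_embedding_in.
by exists (IsometricBij hd ho).
Qed.

Definition product_isometry_fun (g : prodgroup (fun i => Iso (Y i))) (x : X) :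
  X := isometry_preimage phi (fun i => g i (phi x i)).

Lemma product_isometry_coord g x i :
  phi (product_isometry_fun g x) i = g i (phi x i).
Proof. by rewrite /product_isometry_fun isometry_preimageK. Qed.

Lemma product_isometry_dist g : isometric_embedding (product_isometry_fun g).
Proof.
move=> x y; rewrite !mdist_sqdist !(sqdist_coord phi); congr Num.sqrt.
by apply: eq_bigr => i _; rewrite !product_isometry_coord /sqdist isometry_dist.
Qed.

Lemma product_isometry_onto g y : exists x, product_isometry_fun g x = y.
Proof.
exists (isometry_preimage phi (fun i => isometry_preimage (g i) (phi y i))).
apply: (coord_inj (phi := phi)) => i.
by rewrite product_isometry_coord isometry_preimageK isometry_preimageK.
Qed.

Definition product_isometry g : Iso X :=
  IsometricBij (product_isometry_dist g) (product_isometry_onto g).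

Lemma product_isometryM g h :
  product_isometry (g * h)%g = (product_isometry g * product_isometry h)%g.
Proof.
apply: isometryP => x; apply: (coord_inj (phi := phi)) => i.
by rewrite product_isometry_coord /= !product_isometry_coord.
Qed.

Lemma product_isometry_inj : X -> injective product_isometry.
Proof.
move=> o g h gh; apply: functional_extensionality_dep => i.
apply: isometryP => u; rewrite -(fibre_embedding_in phi o u).
rewrite -!product_isometry_coord.
by move: gh => /(congr1 (@isometry_fun _ _ _)) /= ->.
Qed.

(** Stated through agreement of coordinates, so that no transport between [Y i] and [Y (s i)] is
    needed. *)
Definition permutes_factors f (s : {perm I}) : Prop :=
  forall i x y, phi x i = phi y i <-> phi (f x) (s i) = phi (f y) (s i).

Lemma permutes_factorsM f g s t :
  permutes_factors f s -> permutes_factors g t ->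
  permutes_factors (f * g)%g (s * t)%g.
Proof. by move=> fs gt i x y; rewrite permM fs gt. Qed.

Lemma permutes_factors_fibre f s i x : permutes_factors f s ->
  f @` fibre phi i x = fibre phi (s i) (f x).
Proof.
move=> fs; apply/seteqP; split=> [_ [y yx <-] l lsi|y].
  rewrite -(permKV s l); apply: (fs _ _ _).1; apply: yx.
  by apply: contraNneq lsi => <-; rewrite permKV.
have [z <-] := isometry_onto f y; move=> zx; exists z => // j ji.
apply: (fs _ _ _).2.
by apply: zx; rewrite (inj_eq perm_inj).
Qed.

Lemma permutes_factors_isometry f s i : X -> permutes_factors f s ->
  exists h : isometric_bij (Y i) (Y (s i)),
    forall x, phi (f x) (s i) = h (phi x i).
Proof.
move=> o fs; apply: factor_isometry => // [x y /fs//|x y xy l lsi].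
rewrite -(permKV s l); apply: (fs _ _ _).1; apply: xy.
by apply: contraNneq lsi => <-; rewrite permKV.
Qed.

(** Two image points can have coordinates [u] and [v] at [s i] and agree at [t i]; the latter forces
    their preimages to agree at [i], hence [u = v]. *)
Lemma permutes_factors_uniq f s t i : X -> permutes_factors f s ->
  permutes_factors f t -> s i != t i -> forall u v : Y (s i), u = v.
Proof.
move=> o fs ft sti u v.
have [x fx] := isometry_onto f (fibre_embedding phi o u).
have [y fy] := isometry_onto f (fibre_embedding phi o v).
rewrite -(fibre_embedding_in phi o u) -(fibre_embedding_in phi o v) -fx -fy.
apply: (fs _ _ _).1; apply: (ft _ _ _).2.
by rewrite fx fy !fibre_embedding_out // eq_sym.
Qed.

Lemma product_isometry_permutes g : permutes_factors (product_isometry g) 1%g.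
Proof.
move=> i x y; rewrite perm1 !product_isometry_coord.
by split=> [->//|/(congr1 (isometry_preimage (g i)))]; rewrite !isometryK.
Qed.

Lemma permutes_factors1 f : X -> permutes_factors f 1%g ->
  exists g, product_isometry g = f.
Proof.
move=> o f1.
have coord i : {h : Iso (Y i) | forall x, phi (f x) i = h (phi x i)}.
  by apply: cid; have := permutes_factors_isometry i o f1; rewrite perm1.
exists (fun i => sval (coord i)); apply: isometryP => x.
apply: (coord_inj (phi := phi)) => i.
by rewrite product_isometry_coord (svalP (coord i)).
Qed.

Lemma permuting_isometry (s : {perm I}) :
  (forall i, isometric (Y i) (Y (s i))) ->
  exists f : Iso X, permutes_factors f s.
Proof.
move=> isoY.
(* Indexed by the target [l], so that the new coordinate has type [Y l] without a cast. *)
have H l : {h : isometric_bij (Y (s^-1 l)%g) (Y l) | True}.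
  by apply: cid; have := isoY (s^-1 l)%g; rewrite permKV => -[h]; exists h.
pose h l := sval (H l).
pose f x : X := isometry_preimage phi (fun l => h l (phi x (s^-1 l)%g)).
have fE x l : phi (f x) l = h l (phi x (s^-1 l)%g).
  by rewrite /f isometry_preimageK.
have fd : isometric_embedding f.
  move=> x y; rewrite !mdist_sqdist !(sqdist_coord phi); congr Num.sqrt.
  rewrite [RHS](reindex_perm s^-1%g); apply: eq_bigr => l _.
  by rewrite !fE /sqdist isometry_dist.
have fo y : exists x, f x = y.
  (* Quantifying over w avoids a cast along s (s^-1 l) = l. *)
  have coord i : {u : Y i | forall w : l2prod Y, w i = u ->
      forall l, (s^-1 l)%g = i -> h l (w (s^-1 l)%g) = phi y l}.
    apply: cid; rewrite -(permK s i); move: (s i) => l.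
    exists (isometry_preimage (h l) (phi y l)) => w wE l' /perm_inj ->.
    by rewrite wE isometry_preimageK.
  exists (isometry_preimage phi (fun i => sval (coord i))).
  apply: (coord_inj (phi := phi)) => l; rewrite fE isometry_preimageK.
  exact: (svalP (coord (s^-1 l)%g) (fun i => sval (coord i))).
exists (IsometricBij fd fo) => i x y; rewrite /= !fE.
split=> [e|/(congr1 (isometry_preimage (h (s i))))]; last first.
  by rewrite !isometryK permK.
have e' : phi x (s^-1 (s i))%g = phi y (s^-1 (s i))%g by rewrite permK.
by rewrite e'.
Qed.
End Factors.

(** * Assembly of the exact sequence *)

Theorem corollary1p3 (R : realType) (X : metricType R)
  (n : nat) (Y : 'I_n.+1 -> metricType R) (phi : isometric_bij X (l2prod Y))
  (X_geodesic : geodesic X)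
  (X_rank : (affine_rank X < +oo)%E)
  (Y0_euclidean : euclidean (Y ord0))
  (Y_irreducible : forall k : 'I_n, irreducible (Y (lift ord0 k)))
  (Y_not_line : forall k : 'I_n,
    ~ isometric (Y (lift ord0 k)) (R^o : metricType R))
  (Y_not_point : forall k : 'I_n, ~ is_point (Y (lift ord0 k))) :
  exists (i : {multiplicative prodgroup (fun k => Iso (Y k)) -> Iso X})
         (p : {multiplicative Iso X -> [subg factor_perms_group Y]}),
    [/\ short_exact i p,
        forall g x k, phi (i g x) k = g k (phi x k) &
        forall (f : Iso X) (k : 'I_n) x,
          f @` fibre phi (lift ord0 k) x =
          fibre phi (lift ord0 (sgval (p f) k)) (f x)].
Proof.
have nonempty j : {y : Y j | True}.
  apply: cid; have [k ->|->] := unliftP ord0 j.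
    exact: irreducible_nonempty.
  exact: euclidean_nonempty.
pose o : X := isometry_preimage phi (fun j => sval (nonempty j)).
pose ext (s : 'S_n) := lift_perm ord0 ord0 s.
(* [f] followed by [phi] is a second decomposition of [X]. Matching it with [phi] gives the
   permutation, as two points share a coordinate exactly when they share the projection. *)
have permutes f : {s : 'S_n | permutes_factors phi f (ext s)}.
  apply: cid; have [s sP] := coordinate_matching X_geodesic Y0_euclidean
    Y_irreducible Y_not_line Y_not_point phi (isometry_comp f phi) o.
  exists s => j x y; rewrite (coord_eqE phi j o) !sP.
  by rewrite -(coord_eqE (isometry_comp f phi) (ext s j) o).
have uniq f s t : permutes_factors phi f (ext s) ->
    permutes_factors phi f (ext t) -> s = t.
  move=> fs ft; apply/permP => k; apply/eqP/negPn/negP => st.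
  apply: (Y_not_point (s k)); exists (sval (nonempty (lift ord0 (s k)))).
  apply/seteqP; split=> // u _ /=.
  have := permutes_factors_uniq (i := lift ord0 k) o fs ft.
  by rewrite /ext !lift_perm_lift; apply; rewrite (inj_eq lift_inj).
have perms_in f s : permutes_factors phi f (ext s) -> s \in factor_perms Y.
  move=> fs; rewrite inE; apply/asboolP => k.
  have [h _] := permutes_factors_isometry (lift ord0 k) o fs.
  by move: h; rewrite /ext lift_perm_lift => h; exact: inhabits h.
pose p0 f : [subg factor_perms_group Y] := subg _ (sval (permutes f)).
have p0E f : sgval (p0 f) = sval (permutes f).
  by apply: subgK; exact: perms_in (svalP (permutes f)).
have p0P f : permutes_factors phi f (ext (sgval (p0 f))).
  by rewrite p0E; exact: svalP (permutes f).
(* Both products mean the left factor first, so uniqueness of the permutation gives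
   multiplicativity. *)
have p0M f g : p0 (f * g)%g = (p0 f * p0 g)%g.
  apply: subg_inj; apply: (uniq (f * g)%g) => //.
  rewrite [sgval _]/(sgval (p0 f) * sgval (p0 g))%g /ext.
  by rewrite -(lift_permM _ ord0); apply: permutes_factorsM; exact: p0P.
have [p pE] := multiplicative_of_morph p0M.
have [i iE] := multiplicative_of_morph (product_isometryM phi).
have ext1 : ext 1%g = 1%g by exact: lift_perm1.
exists i, p; split.
- split.
  + by rewrite iE; exact: product_isometry_inj.
  + apply/seteqP; split=> [_ [g _ <-]|f] /=.
      rewrite pE iE; apply: subg_inj.
      apply: (uniq (product_isometry phi g)) => //.
      by rewrite ext1; exact: product_isometry_permutes.
    rewrite pE => pf; have := p0P f; rewrite pf ext1.
    move=> /(permutes_factors1 o)[g gf]; exists g => //.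
    by rewrite iE.
  (* The identity of the Euclidean factor completes the isometries between the factors that [s]
     provides. *)
  + rewrite pE; apply/seteqP; split=> // s _.
    have sY : sgval s \in factor_perms Y := subgP s.
    have isoY j : isometric (Y j) (Y (ext (sgval s) j)).
      have [k ->|->] := unliftP ord0 j; rewrite /ext.
        by rewrite lift_perm_lift; move: sY; rewrite inE => /asboolP.
      by rewrite lift_perm_id; exact: inhabits (isometry_id _).
    have [f fs] := permuting_isometry phi isoY.
    by exists f => //; apply: subg_inj; apply: (uniq f).
- by move=> g x k; rewrite iE; exact: product_isometry_coord.
- move=> f k x; rewrite pE (permutes_factors_fibre _ _ (p0P f)).
  by rewrite /ext lift_perm_lift.
Qed.
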